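(* For every integer $d\geq 1$ there is a countably infinite set $X_d\subset\mathbb{R}^d$ such that $\lVert x-y\rVert\in\mathbb{Q}$ for all $x,y\in X_d$ and $X_d$ is in affine general position. If $d$ is odd, $X_d$ may be chosen in general position (that is, for every odd $d\ge 1$ there is a countably infinite set $X_d\subset\mathbb{R}^d$ with all pairwise distances rational which is in general position).
   Context: $\lVert\cdot\rVert$ is the standard Euclidean norm. A set $P\subset\mathbb{R}^d$ is in affine general position if every $d+1$ distinct points of $P$ are affinely independent. It is in general position if it is in affine general position and no $d+2$ distinct points of $P$ are cospherical, i.e. lie on a common sphere in $\mathbb{R}^d$. *)

(* Defs.v *)
From HB Require Import structures.
From mathcomp Require Import all_boot all_order all_algebra.
From mathcomp Require Import boolp classical_sets functions cardinality reals.

Set Implicit Arguments.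
Unset Strict Implicit.
Unset Printing Implicit Defensive.

Import Order.TTheory GRing.Theory Num.Theory.

Local Open Scope classical_set_scope.
Local Open Scope ring_scope.

(* The norm that MathComp-Analysis puts on matrices is the sup norm, so the
   Euclidean norm of R^d is defined here. *)
Definition enorm (R : realType) (d : nat) (v : 'rV[R]_d) : R :=
  Num.sqrt (\sum_(i < d) v 0 i ^+ 2).

Definition rational_distances (R : realType) (d : nat) (X : set 'rV[R]_d) :=
  forall x y, X x -> X y -> rational (enorm (x - y)).

Definition affinely_independent (R : realType) (d k : nat)
    (p : 'I_k -> 'rV[R]_d) :=
  forall c : 'I_k -> R,
    \sum_(i < k) c i = 0 -> \sum_(i < k) c i *: p i = 0 -> forall i, c i = 0.

Definition cospherical (R : realType) (d k : nat) (p : 'I_k -> 'rV[R]_d) :=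
  exists (o : 'rV[R]_d) (r : R), 0 < r /\ forall i, enorm (p i - o) = r.

Definition affine_general_position (R : realType) (d : nat)
    (X : set 'rV[R]_d) :=
  forall p : 'I_d.+1 -> 'rV[R]_d,
    injective p -> (forall i, X (p i)) -> affinely_independent p.

Definition general_position (R : realType) (d : nat) (X : set 'rV[R]_d) :=
  affine_general_position X /\
  forall p : 'I_d.+2 -> 'rV[R]_d,
    injective p -> (forall i, X (p i)) -> ~ cospherical p.

(* Main.v *)
Require Import Defs.
From HB Require Import structures.
From mathcomp Require Import all_boot all_order all_algebra.
From mathcomp Require Import boolp classical_sets functions cardinality reals.
From mathcomp Require Import complex ring lra zify.

(** An infinite family of points on one curve does the work in all dimensions.

    For weights b_0, ..., b_n put f(t) = sum_p b_p sin((2p+1) t).  Expanding the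
    products of sines, 2 f(t)^2 = sum_l c_l (1 - cos(2(l+1) t)) for
    l = 0, ..., 2n, where the c_l are explicit quadratic forms in the b_p
    ([sine_sum_square]).  If no c_l is negative, then 2 |f(t - s)| is the
    Euclidean distance between the points with parameters t and s on the curve
    whose coordinates are sqrt(c_l) cos(2(l+1) t) and sqrt(c_l) sin(2(l+1) t),
    for the l with c_l <> 0 ([trig_curve_dist]).  When the b_p are rational,
    that distance is rational as soon as exp(it) and exp(is) have rational
    coordinates, which happens for infinitely many parameters.  This curve lies
    on a sphere about the origin of R^(2m), where m is the number of nonzero
    c_l.  Rapidly decreasing weights make all c_l positive, so m = 2n+1; the
    weight b_1 occurs linearly in c_0 and can be tuned so that c_0 = 0 while
    the others stay positive, so m = 2n ([convolution_weights]).  Hence every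
    even dimension is reached.

    A hyperplane meets the curve in finitely many points, because its equation
    becomes a nonzero polynomial equation in exp(it)
    ([trig_curve_hyperplane]).  One can therefore choose points greedily, each
    outside the hyperplanes spanned by the earlier ones
    ([greedy_affinely_general]), which proves the even case.

    For odd d take such a set in R^(d+1) and invert it about one of its points o
    ([invert_spherical]).  An inversion multiplies the distance of x and y by
    1 / (|x - o| |y - o|), which is rational, and it sends the sphere through o
    to a hyperplane, a copy of R^d.  If d+1 image
    points lie in a hyperplane of R^d, then their preimages and o are d+2 points
    of a hyperplane of R^(d+1); if d+2 image points lie on a sphere of R^d, then
    their d+2 preimages lie in a hyperplane of R^(d+1).  Neither occurs for
    points in affine general position. *)

Set Implicit Arguments.
Unset Strict Implicit.
Unset Printing Implicit Defensive.

Import Order.TTheory GRing.Theory Num.Theory.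

Local Open Scope classical_set_scope.
Local Open Scope card_scope.
Local Open Scope ring_scope.

(** * The bilinear form of coordinates *)

Definition dot (F : pzRingType) (d : nat) (x y : 'rV[F]_d) : F :=
  (x *m y^T) 0 0.

Lemma dotE (F : pzRingType) (d : nat) (x y : 'rV[F]_d) :
  dot x y = \sum_(i < d) x 0 i * y 0 i.
Proof. by rewrite /dot mxE; apply: eq_bigr => i _; rewrite mxE. Qed.

Lemma dotDl (F : pzRingType) (d : nat) (x y z : 'rV[F]_d) :
  dot (x + y) z = dot x z + dot y z.
Proof. by rewrite /dot mulmxDl mxE. Qed.

Lemma dotZl (F : pzRingType) (d : nat) (a : F) (x y : 'rV[F]_d) :
  dot (a *: x) y = a * dot x y.
Proof. by rewrite /dot -scalemxAl mxE. Qed.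

Lemma dotC (F : comPzRingType) (d : nat) (x y : 'rV[F]_d) : dot x y = dot y x.
Proof. by rewrite !dotE; apply: eq_bigr => i _; rewrite mulrC. Qed.

Lemma dotDr (F : comPzRingType) (d : nat) (x y z : 'rV[F]_d) :
  dot x (y + z) = dot x y + dot x z.
Proof. by rewrite dotC dotDl !(dotC x). Qed.

Lemma dotZr (F : comPzRingType) (d : nat) (a : F) (x y : 'rV[F]_d) :
  dot x (a *: y) = a * dot x y.
Proof. by rewrite dotC dotZl dotC. Qed.

Lemma dot_sumr (F : comPzRingType) (d : nat) (I : finType) (x : 'rV[F]_d)
    (y : I -> 'rV[F]_d) : dot x (\sum_i y i) = \sum_i dot x (y i).
Proof. by rewrite /dot raddf_sum mulmx_sumr summxE. Qed.

Lemma dotNl (F : pzRingType) (d : nat) (x y : 'rV[F]_d) : dot (- x) y = - dot x y.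
Proof. by rewrite -scaleN1r dotZl mulN1r. Qed.

Lemma dotNr (F : comPzRingType) (d : nat) (x y : 'rV[F]_d) : dot x (- y) = - dot x y.
Proof. by rewrite dotC dotNl dotC. Qed.

Lemma dot_eq0 (F : realDomainType) (d : nat) (x : 'rV[F]_d) : (dot x x == 0) = (x == 0).
Proof.
rewrite dotE psumr_eq0 => [|i _]; last by rewrite -expr2 sqr_ge0.
apply/allP/eqP => [x0|->]; last by move=> i _; rewrite mxE mul0r eqxx.
apply/matrixP => i j; rewrite ord1 mxE; have := x0 j (mem_index_enum _).
by rewrite /= mulf_eq0 orbb => /eqP.
Qed.

Lemma dot_ge0 (F : realDomainType) (d : nat) (x : 'rV[F]_d) : 0 <= dot x x.
Proof. by rewrite dotE sumr_ge0 // => i _; rewrite -expr2 sqr_ge0. Qed.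

Lemma dot_mulmx (F : comPzRingType) (d n : nat) (x : 'rV[F]_d)
    (M : 'M_(d, n)) (y : 'rV_n) :
  dot (x *m M) y = dot x (y *m M^T).
Proof. by rewrite /dot trmx_mul trmxK mulmxA. Qed.

Definition dotDE := (dotDl, dotDr, dotNl, dotNr, dotZl, dotZr).

Lemma enormE (R : realType) (d : nat) (v : 'rV[R]_d) : enorm v = Num.sqrt (dot v v).
Proof. by rewrite /enorm dotE. Qed.

(** * Greedy choice of points in affine general position *)

Lemma hyperplane_through (F : fieldType) (d : nat) (q : 'I_d.+1 -> 'rV[F]_d.+1) :
  exists w c, w != 0 /\ forall j, dot w (q j) = c.
Proof.
(* The equations w . q_j - c = 0 are d + 1 homogeneous conditions on the d + 2
   unknowns (w, c). *)
pose A : 'M[F]_(d.+1, d.+1 + 1) := row_mx (\matrix_j q j) (const_mx (-1)).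
have : kermx A^T != 0.
  rewrite kermx_eq0 /row_free; apply: contraTneq (rank_leq_col A^T) => ->.
  by rewrite addn1 ltnn.
case/rowV0Pn => v /sub_kermxP vA v0.
have qv j : dot (lsubmx v) (q j) = rsubmx v 0 0.
  move/matrixP/(_ 0 j): vA.
  rewrite -[v in v *m _]hsubmxK tr_row_mx mul_row_col !mxE big_ord1 !mxE mulrN1.
  move/eqP; rewrite subr_eq0 => /eqP <-; rewrite dotE.
  by apply: eq_bigr => i _; rewrite !mxE.
(* If w = 0, then c = w . q_0 = 0 as well, against v <> 0. *)
exists (lsubmx v), (rsubmx v 0 0); split=> //; apply: contra_neq v0 => w0.
have c0 : rsubmx v = 0.
  apply/matrixP => i j; rewrite !ord1 -(qv ord0) w0 dotE mxE big1 // => k _.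
  by rewrite mxE mul0r.
by rewrite -[v]hsubmxK w0 c0 row_mx0.
Qed.

(** Only finitely many (d+1)-tuples have indices below [N], each lies in a
    hyperplane, and the sequence eventually leaves all of these hyperplanes. *)
Lemma eventually_avoid_spans (F : fieldType) (d : nat) (f : nat -> 'rV[F]_d.+1)
    (hf : forall w c, w != 0 -> exists N, forall i, (N <= i)%N ->
       dot w (f i) <> c) (N : nat) :
  exists M, (N <= M)%N /\
    forall (t : 'I_d.+1 -> nat) (a : 'I_d.+1 -> F),
      (forall j, (t j < N)%N) -> \sum_j a j = 1 ->
      f M <> \sum_j a j *: f (t j).
Proof.
have /choice[b hb] : forall t : {ffun 'I_d.+1 -> 'I_N}, exists K, forall i,
    (K <= i)%N -> forall a : 'I_d.+1 -> F, \sum_j a j = 1 ->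
    f i <> \sum_j a j *: f (t j).
  move=> t; have [w [c [w0 wc]]] := hyperplane_through (fun j => f (t j)).
  have [K hK] := hf w c w0; exists K => i /hK fi a a1 e; apply: fi.
  rewrite e dot_sumr (eq_bigr (fun j => a j * c)); last first.
    by move=> j _; rewrite dotZr wc.
  by rewrite -mulr_suml a1 mul1r.
exists (maxn N (\max_t b t)%N); split; first exact: leq_maxl.
move=> t a tN a1 e; pose t' := [ffun j => Ordinal (tN j)].
apply: (hb t' (maxn N (\max_t b t)%N) _ a a1).
  by rewrite leq_max (leq_bigmax t') orbT.
by rewrite e; apply: eq_bigr => j _; rewrite ffunE.
Qed.

Definition affinely_general (R : realType) (d : nat) (p : nat -> 'rV[R]_d) :=
  forall t : 'I_d.+1 -> nat, injective t -> affinely_independent (p \o t).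

(** In a nontrivial affine relation, the point of largest index with a nonzero
    coefficient would be an affine combination of earlier ones. *)
Lemma new_points_affinely_general (R : realType) (d : nat)
    (p : nat -> 'rV[R]_d)
    (hp : forall k (t : 'I_d -> nat) (a : 'I_d -> R),
       (forall j, (t j < k)%N) -> \sum_j a j = 1 ->
       p k <> \sum_j a j *: p (t j)) :
  affinely_general p.
Proof.
move=> t t_inj c c0 cp i0; apply/eqP/negPn/negP => ci0.
case: (@arg_maxnP _ i0 (fun i => c i != 0) t ci0) => i ci imax {i0 ci0}.
have lt_i j : j != i -> c j != 0 -> (t j < t i)%N.
  move=> ji cj; have tji : (t j <= t i)%N := imax j cj.
  rewrite ltn_neqAle tji andbT.
  by apply: contra_neq ji; apply: t_inj.
have ti0 : (0 < t i)%N.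
  have [[j [ji cj]]|h] := pselect (exists j, j != i /\ c j != 0).
    by apply: leq_trans (lt_i j ji cj).
  case/eqP: ci; rewrite -[RHS]c0 (bigD1 i) //= big1 ?addr0 // => j ji.
  by apply/eqP/negPn/negP => cj; apply: h; exists j.
(* The points with coefficient 0 may have large indices; index 0 replaces them. *)
pose t' j := if c (lift i j) == 0 then 0%N else t (lift i j).
pose a j := - (c i)^-1 * c (lift i j).
apply: (hp (t i) t' a).
- move=> j; rewrite /t'; case: eqVneq => // cj; apply: lt_i => //.
  by rewrite eq_sym neq_lift.
- rewrite -mulr_sumr; move: c0; rewrite (bigD1_ord i) //= => /eqP.
  by rewrite addrC addr_eq0 => /eqP ->; rewrite mulNr mulrN opprK mulVf.
have -> : \sum_j a j *: p (t' j) = - (c i)^-1 *: \sum_j c (lift i j) *: p (t (lift i j)).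
  rewrite scaler_sumr; apply: eq_bigr => j _; rewrite scalerA /t' /a.
  by case: eqVneq => // ->; rewrite mulr0 !scale0r.
move: cp; rewrite (bigD1_ord i) //= => /eqP.
rewrite addrC addr_eq0 => /eqP ->.
by rewrite scaleNr scalerN opprK scalerA mulVf // scale1r.
Qed.

Lemma greedy_affinely_general (R : realType) (d : nat) (f : nat -> 'rV[R]_d.+1)
    (hf : forall w c, w != 0 -> exists N, forall i, (N <= i)%N ->
       dot w (f i) <> c) :
  exists s : nat -> nat, injective (f \o s) /\ affinely_general (f \o s).
Proof.
have /choice[g hg] := eventually_avoid_spans hf.
(* Every index chosen before step k + 1 is at most s k, so it suffices that
   s k.+1 avoids the spans of all points with indices below (s k).+1. *)
pose s k := iter k (fun m => g m.+1) 0%N.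
have s_lt j k : (j < k)%N -> (s j < s k)%N.
  have hS m : (s m < s m.+1)%N by have [] := hg (s m).+1.
  by move=> jk; apply: (homo_ltn ltn_trans hS).
have s_new k (t : 'I_d.+1 -> nat) (a : 'I_d.+1 -> R) :
    (forall j, (t j < k)%N) -> \sum_j a j = 1 ->
    f (s k) <> \sum_j a j *: f (s (t j)).
  case: k => [|k] tk a1; first by have := tk ord0.
  have [_ h] := hg (s k).+1; apply: (h (s \o t)) => // j.
  rewrite ltnS /=; have := tk j; rewrite ltnS leq_eqVlt => /orP[/eqP-> //|].
  by move/s_lt/ltnW.
exists s; split; last exact: new_points_affinely_general.
have f_neq j k : (j < k)%N -> f (s k) <> f (s j).
  move=> jk fkj; apply: (s_new k (fun=> j) (fun i => (i == ord0)%:R)) => //.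
    by rewrite big_ord_recl big1 ?addr0.
  by rewrite big_ord_recl big1 ?addr0 ?scale1r // => i _; rewrite scale0r.
by move=> j k /= fjk; case: (ltngtP j k) => // /f_neq; case.
Qed.

(** * Weights whose convolution coefficients are positive *)

(** The coefficient of 1 - cos(2(l+1) t) in 2 f(t)^2, for
    f(t) = sum_(p <= n) b_p sin((2p+1) t): the first sum comes from the
    frequency sums (2p+1) + (2q+1), the second from the differences
    (2q+1) - (2p+1) with p < q. *)
Definition conv_coef (F : pzRingType) (b : nat -> F) (n l : nat) : F :=
  \sum_(p < n.+1) \sum_(q < n.+1 | (p + q == l)%N) b p * b q
  - (\sum_(p < n.+1) \sum_(q < n.+1 | (p + l.+1 == q)%N) b p * b q) *+ 2.

Lemma geometric_tail (F : realFieldType) (a m : nat) :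
  \sum_(i < m) 4^-1 ^+ (a + i) <= 4 / 3 * 4^-1 ^+ a :> F.
Proof.
suff -> : \sum_(i < m) 4^-1 ^+ (a + i) = 4 / 3 * (4^-1 ^+ a - 4^-1 ^+ (a + m)) :> F.
  rewrite ler_pM2l ?divr_gt0 // gerBl exprn_ge0 ?invr_ge0 //.
elim: m => [|m IH]; first by rewrite big_ord0 addn0 subrr mulr0.
by rewrite big_ord_recr /= IH addnS exprS; field.
Qed.

(** Decreasing geometrically, except that the weight of index 1 is free. *)
Definition geometric_weights (F : unitRingType) (x : F) (p : nat) : F :=
  if p == 1%N then x else 4^-1 ^+ p.

(** The negative part is a geometric tail: a frequency difference l + 1 needs a
    weight of index at least l + 1.  The sum l, for 1 <= l <= n+1, is reached by
    the indices 1 and l - 1 (by 0 and 1 if l = 1), which gives at least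
    x 4^-(l-1); the lower bound on [x] makes this win.  For l > n+1 there is no
    negative part.  The argument fails for l = 0, where the negative part
    contains the product [x] of the weights of indices 0 and 1. *)
Lemma conv_coef_gt0 (F : realFieldType) (x : F) (n l : nat) :
  4^-1 <= x <= 1 -> (0 < l <= n.*2)%N -> 0 < conv_coef (geometric_weights x) n l.
Proof.
move=> /andP[x_ge x_le] /andP[l_gt0 l_le]; set b := geometric_weights x.
have x_gt0 : 0 < x by apply: lt_le_trans x_ge; rewrite invr_gt0.
have b_gt0 p : 0 < b p.
  rewrite /b /geometric_weights; case: ifP => // _.
  by rewrite exprn_gt0 // invr_gt0.
have b_le1 p : b p <= 1.
  rewrite /b /geometric_weights; case: ifP => // _; rewrite exprn_ile1 //.
    by rewrite invr_ge0.
  by rewrite invf_le1 // ler1n.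
have first_ge p q : (p <= n)%N -> (q <= n)%N -> (p + q = l)%N -> b p * b q <=
    \sum_(p < n.+1) \sum_(q < n.+1 | (p + q == l)%N) b p * b q.
  move=> pn qn pq; rewrite (bigD1 (inord p)) //= (bigD1 (inord q)) /=; last first.
    by rewrite !inordK // pq.
  rewrite !inordK // -addrA lerDl addr_ge0 //.
    by apply: sumr_ge0 => i _; apply: mulr_ge0; apply: ltW.
  by apply: sumr_ge0 => i _; apply: sumr_ge0 => j _; apply: mulr_ge0; apply: ltW.
rewrite /conv_coef subr_gt0; have [l_n|n_l] := leqP l n.+1; last first.
  rewrite [X in X *+ 2]big1 ?mul0rn; last first.
    by move=> p _; rewrite big_pred0 // => q; have := ltn_ord q; lia.
  by apply: lt_le_trans (first_ge n (l - n)%N _ _ _); rewrite ?mulr_gt0 //; lia.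
apply: (@lt_le_trans _ _ (x * 4^-1 ^+ l.-1)); last first.
  case: l l_gt0 l_le first_ge l_n => [|[|[|l]]] // _ l_le first_ge l_n.
  - have := first_ge 0%N 1%N; rewrite /b /geometric_weights /=.
    by rewrite !expr0 mulr1 mul1r; apply=> //; lia.
  - apply: le_trans (first_ge 1%N 1%N _ _ _) => //; try lia.
    by rewrite /b /geometric_weights /= expr1 ler_pM2l.
  - apply: le_trans (first_ge 1%N l.+2 _ _ _) => //; lia.
(* In the negative part q = p + (l + 1), so there is at most one term for each p,
   bounded by the weight of index q. *)
apply: (@le_lt_trans _ _ ((\sum_(i < n.+1) 4^-1 ^+ (l.+1 + i)) *+ 2)).
  rewrite lerMn2r /=; apply: ler_sum => p _; rewrite addnC.
  case: (ltnP (l.+1 + p) n.+1) => h; last first.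
    rewrite big_pred0 ?exprn_ge0 ?invr_ge0 // => q; move: h; have := ltn_ord q; lia.
  rewrite (big_pred1 (Ordinal h)); last by move=> q; rewrite /= -val_eqE eq_sym.
  rewrite {2}/b /geometric_weights /= ifN; last by lia.
  by rewrite ler_piMl // exprn_ge0 ?invr_ge0.
apply: (@le_lt_trans _ _ (4 / 3 * 4^-1 ^+ l.+1 *+ 2)).
  by rewrite lerMn2r geometric_tail orbT.
rewrite -{1}(prednK l_gt0) !exprS -mulr_natr.
have : 0 < 4^-1 ^+ l.-1 :> F by rewrite exprn_gt0 // invr_gt0.
move: (_ ^+ _) x_ge => u x_ge u_gt0; nra.
Qed.

(** The coefficient of index 0 is affine in [x], so that it vanishes at a rational
    point; the bound on the tail [S] places this point above 1/4. *)
Lemma conv_coef0 (F : realFieldType) (n : nat) : exists S : F,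
  [/\ 0 <= S <= 12^-1 &
  forall x, conv_coef (geometric_weights x) n.+1 0 =
            1 - 2 * (x + (if n is 0%N then 0 else x / 16) + S)].
Proof.
have h x : conv_coef (geometric_weights x) n.+1 0 =
    1 - 2 * \sum_(p < n.+1) geometric_weights x p * geometric_weights x p.+1.
  rewrite /conv_coef; congr (_ - _).
    rewrite big_ord_recl (big_pred1 ord0) ?big1 ?addr0 /geometric_weights /= ?expr0 ?mulr1 //.
      by move=> i _; rewrite big_pred0.
  rewrite mulr_natl; congr (_ *+ 2).
  rewrite big_ord_recr /= [X in _ + X]big_pred0 ?addr0; last first.
    by move=> q; have := ltn_ord q; lia.
  apply: eq_bigr => p _; rewrite (big_pred1 (lift ord0 p)) // => q.
  by rewrite /= -val_eqE /= eq_sym /bump addn1.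
case: n h => [|n] h.
  exists 0; split=> [|x]; first by rewrite lexx invr_ge0 /=.
  by rewrite h big_ord1 /geometric_weights /= expr0 mul1r !addr0.
exists (\sum_(i < n) 4^-1 ^+ (i.+2 + i.+3)); split=> [|x]; last first.
  rewrite h 2!big_ord_recl /=; congr (1 - 2 * _).
  rewrite /geometric_weights /= expr0 mul1r addrA; congr (_ + _ + _).
    by field.
  by apply: eq_bigr => i _; rewrite exprD.
apply/andP; split; first by apply: sumr_ge0 => i _; rewrite exprn_ge0 ?invr_ge0.
apply: (@le_trans _ _ (\sum_(i < n) 4^-1 ^+ (2 + i))).
  apply: ler_sum => i _; apply: ler_wiXn2l; rewrite ?invr_ge0 ?invf_le1 ?ler1n //; lia.
apply: le_trans (geometric_tail _ _ _) _; lra.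
Qed.

(** [m] of the [n.*2.+1] coefficients are positive and the first [e] vanish:
    [e] is 0 for odd [m], with [x = 1/4], and 1 for even [m], where [x] solves
    the affine equation given by [conv_coef0]. *)
Lemma convolution_weights (m : nat) : (0 < m)%N ->
  exists (n e : nat) (b : nat -> rat),
  [/\ (m + e = n.*2.+1)%N,
      forall l, (l < e)%N -> conv_coef b n l = 0 &
      forall l, (e <= l < n.*2.+1)%N -> 0 < conv_coef b n l].
Proof.
move=> m_gt0; have [m_odd|m_even] := boolP (odd m).
  exists m./2, 0%N, (geometric_weights 4^-1); split=> //.
    by rewrite addn0; have := odd_double_half m; rewrite m_odd add1n.
  move=> [_|l /andP[_ l_lt]]; last by apply: conv_coef_gt0; rewrite ?lexx.
  case: m./2 => [|n].
    rewrite /conv_coef !big_ord1 (big_pred1 ord0) ?big_pred0 ?mul0rn ?subr0 //= => q.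
    by rewrite (ord1 q).
  have [S [S_bd cS]] := conv_coef0 rat n.
  by rewrite cS; case: n {cS} => [|n]; lra.
have [n m_eq] : exists n, m = n.+1.*2.
  by exists (m./2.-1); have := odd_double_half m; rewrite (negbTE m_even); lia.
have [x x_bd cx] : exists2 x : rat, 4^-1 <= x <= 1 &
    conv_coef (geometric_weights x) n.+1 0 = 0.
  have [S [S_bd cS]] := conv_coef0 rat n.
  exists (if n is 0%N then 2^-1 - S else (2^-1 - S) * 16 / 17); last first.
    by rewrite cS; case: n {cS m_eq} => [|n]; field.
  by case: n {cS m_eq} => [|n]; lra.
exists n.+1, 1%N, (geometric_weights x); split.
- by rewrite m_eq addn1.
- by case.
- by move=> [|l] //= l_lt; apply: conv_coef_gt0.
Qed.

(** * Rational numbers and the unit circle *)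

Section RationalNumbers.
Variable R : realType.
Implicit Types x y : R.

Lemma rational_ratr (q : rat) : rational (ratr q : R).
Proof. by exists q. Qed.

Lemma rationalD x y : rational x -> rational y -> rational (x + y).
Proof. by move=> [p _ <-] [q _ <-]; exists (p + q); rewrite ?rmorphD. Qed.

Lemma rationalN x : rational x -> rational (- x).
Proof. by move=> [p _ <-]; exists (- p); rewrite ?rmorphN. Qed.

Lemma rationalM x y : rational x -> rational y -> rational (x * y).
Proof. by move=> [p _ <-] [q _ <-]; exists (p * q); rewrite ?rmorphM. Qed.

Lemma rationalV x : rational x -> rational x^-1.
Proof. by move=> [p _ <-]; exists p^-1; rewrite ?fmorphV. Qed.

Lemma rational_nat n : rational (n%:R : R).
Proof. by exists n%:R; rewrite ?ratr_nat. Qed.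

Lemma rationalX x n : rational x -> rational (x ^+ n).
Proof. by move=> [p _ <-]; exists (p ^+ n); rewrite ?rmorphXn. Qed.

Lemma rational_sum (I : finType) (P : pred I) (f : I -> R) :
  (forall i, P i -> rational (f i)) -> rational (\sum_(i | P i) f i).
Proof.
by apply: big_ind => [|x y]; [exact: (rational_nat 0)|exact: rationalD].
Qed.

Lemma rational_norm x : rational x -> rational `|x|.
Proof. by move=> hx; case: ger0P => _ //; exact: rationalN. Qed.

End RationalNumbers.

Section UnitCircle.
Variable R : realType.

Definition on_unit_circle (z : R[i]) :=
  complex.Re z ^+ 2 + complex.Im z ^+ 2 = 1.

Lemma mul_conj_unit (z : R[i]) : on_unit_circle z -> z * z^*%C = 1.
Proof.
case: z => a b; rewrite /on_unit_circle /= => h; apply/eqP; rewrite eq_complex /=.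
by rewrite mulrN opprK -!expr2 h eqxx /= mulrN addrC mulrC subrr eqxx.
Qed.

Lemma unit_circleP (z : R[i]) : on_unit_circle z <-> z * z^*%C = 1.
Proof.
split; first exact: mul_conj_unit.
by case: z => a b /eqP; rewrite eq_complex /= mulrN opprK -!expr2 => /andP[/eqP].
Qed.

Lemma unit_circleM (z u : R[i]) :
  on_unit_circle z -> on_unit_circle u -> on_unit_circle (z * u).
Proof.
move=> /unit_circleP hz /unit_circleP hu; apply/unit_circleP.
by rewrite rmorphM mulrACA hz hu mulr1.
Qed.

Lemma unit_circleJ (z : R[i]) : on_unit_circle z -> on_unit_circle z^*%C.
Proof. by case: z => a b; rewrite /on_unit_circle /= sqrrN. Qed.

Lemma unit_circleX (z : R[i]) n : on_unit_circle z -> on_unit_circle (z ^+ n).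
Proof.
move=> hz; elim: n => [|n IH]; last by rewrite exprS; apply: unit_circleM.
by apply/unit_circleP; rewrite expr0 rmorph1 mulr1.
Qed.

End UnitCircle.

Section RationalComplex.
Variable R : realType.

Definition rational_complex (z : R[i]) :=
  rational (complex.Re z) /\ rational (complex.Im z).

Lemma rational_complexM z u :
  rational_complex z -> rational_complex u -> rational_complex (z * u).
Proof.
case: z u => [a b] [c d] [/= ra rb] [/= rc rd]; split=> /=.
  by apply: rationalD; [|apply: rationalN]; apply: rationalM.
by apply: rationalD; apply: rationalM.
Qed.

Lemma rational_complexJ z : rational_complex z -> rational_complex z^*%C.
Proof. by case: z => a b [/= ra rb]; split=> //=; exact: rationalN. Qed.

Lemma rational_complexX z n : rational_complex z -> rational_complex (z ^+ n).
Proof.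
move=> hz; elim: n => [|n IH]; last by rewrite exprS; apply: rational_complexM.
by split; [exact: (rational_nat _ 1)|exact: (rational_nat _ 0)].
Qed.

Definition rational_circle_point (i : nat) : R[i] :=
  Complex ((1 - i%:R ^+ 2) / (1 + i%:R ^+ 2)) (i%:R *+ 2 / (1 + i%:R ^+ 2)).

Let den_gt0 (i : nat) : 0 < 1 + i%:R ^+ 2 :> R.
Proof. by rewrite ltr_pwDl // exprn_ge0. Qed.

Lemma rational_circle_point_unit i : on_unit_circle (rational_circle_point i).
Proof. by rewrite /on_unit_circle /=; field; rewrite gt_eqF. Qed.

Lemma rational_circle_point_inj : injective rational_circle_point.
Proof.
have den0 i : 1 + i%:R ^+ 2 != 0 :> R by rewrite lt0r_neq0.
move=> i j [/eqP]; rewrite (eqr_div _ _ (den0 i) (den0 j)) => /eqP e _.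
have : i%:R ^+ 2 = j%:R ^+ 2 :> R by lra.
by move/eqP; rewrite eqrXn2 // eqr_nat => /eqP.
Qed.

Lemma rational_circle_point_rational i :
  rational_complex (rational_circle_point i).
Proof.
have ri2 : rational (i%:R ^+ 2 : R) by apply: rationalX; apply: rational_nat.
have rden : rational ((1 + i%:R ^+ 2)^-1 : R).
  by apply: rationalV; apply: rationalD => //; exact: (rational_nat _ 1).
split; apply: rationalM => //.
  by apply: rationalD; [exact: (rational_nat _ 1)|exact: rationalN].
by rewrite -mulrnA; exact: rational_nat.
Qed.

End RationalComplex.

(** * The square of a sum of odd sines *)

Lemma sum_sym_offdiag (F : nmodType) (n : nat) (G : 'I_n -> 'I_n -> F) :
  (forall p q, G p q = G q p) -> (forall p, G p p = 0) ->
  \sum_p \sum_q G p q = (\sum_(p < n) \sum_(q < n | (p < q)%N) G p q) *+ 2.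
Proof.
move=> G_sym G_diag; rewrite mulr2n [X in _ = _ + X](exchange_big_dep xpredT) //=.
rewrite -big_split.
apply: eq_bigr => p _; rewrite (bigID (fun q : 'I_n => (p < q)%N)) /=; congr (_ + _).
rewrite (bigD1 p) ?ltnn //= G_diag add0r; apply: eq_big => q; last by rewrite G_sym.
by rewrite -leqNgt ltn_neqAle andbC.
Qed.

Section CosineExpansion.
Variables (R : realType) (y : R[i]).
Hypothesis y_unit : on_unit_circle y.

Lemma mul_Im (u v : R[i]) : complex.Im u * complex.Im v *+ 2 =
  complex.Re (u * v^*%C) - complex.Re (u * v).
Proof. by case: u v => [a b] [c d] /=; ring. Qed.

Lemma Re_mul_conjC (u v : R[i]) :
  complex.Re (u * v^*%C) = complex.Re (v * u^*%C).
Proof. by case: u v => [a b] [c d] /=; ring. Qed.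

Lemma unit_exp_mul_conj (p k : nat) : y ^+ (p + k) * (y ^+ p)^*%C = y ^+ k.
Proof.
by rewrite rmorphXn exprD mulrAC -exprMn (mul_conj_unit y_unit) expr1n mul1r.
Qed.

(** For y = exp(it), [complex.Im (y ^+ k)] and [complex.Re (y ^+ k)] are sin(kt)
    and cos(kt).  The constant term of the cosine expansion is eliminated by
    writing 1 - cos in place of cos: both sides vanish at t = 0. *)
Lemma sine_sum_square (b : nat -> R) (n : nat) :
  (\sum_(p < n.+1) b p * complex.Im (y ^+ p.*2.+1)) ^+ 2 *+ 2 =
  \sum_(l < n.*2.+1) conv_coef b n l * (1 - complex.Re (y ^+ l.+1.*2)).
Proof.
pose E k := 1 - complex.Re (y ^+ k.*2).
pose D p q := 1 - complex.Re (y ^+ p.*2.+1 * (y ^+ q.*2.+1)^*%C).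
have D_sym p q : D p q = D q p.
  by rewrite /D Re_mul_conjC.
have D_shift p k : D (p + k)%N p = E k.
  by rewrite /D doubleD -addSn unit_exp_mul_conj.
pose G (p q : 'I_n.+1) := b p * b q * D p q.
have -> : (\sum_(p < n.+1) b p * complex.Im (y ^+ p.*2.+1)) ^+ 2 *+ 2 =
    \sum_(p < n.+1) \sum_(q < n.+1) b p * b q * E (p + q).+1 -
    \sum_p \sum_q G p q.
  rewrite -sumrB expr2 mulr_suml -sumrMnl; apply: eq_bigr => p _.
  rewrite -sumrB mulr_sumr -sumrMnl; apply: eq_bigr => q _.
  rewrite mulrACA -mulrnAr mul_Im /G /E /D -exprD.
  by rewrite (_ : p.*2.+1 + q.*2.+1 = (p + q).+1.*2)%N; [ring|lia].
have D_diag p : D p p = 0.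
  by have := D_shift p 0%N; rewrite addn0 /E expr0 subrr.
rewrite (@sum_sym_offdiag _ _ G); last first.
- by move=> p; rewrite /G D_diag mulr0.
- by move=> p q; rewrite /G D_sym (mulrC (b p)).
under [RHS]eq_bigr => l _ do rewrite mulrBl mulrnAl !mulr_suml.
rewrite sumrB sumrMnl; congr (_ - _ *+ 2).
  under [RHS]eq_bigr => l _ do under eq_bigr => p _ do rewrite mulr_suml.
  rewrite [RHS]exchange_big; apply: eq_bigr => p _.
  rewrite (partition_big (fun q : 'I_n.+1 => inord (p + q) : 'I_n.*2.+1) xpredT) //=.
  apply: eq_bigr => l _; apply: eq_big => [q|q /eqP <-].
    by rewrite -val_eqE /= inordK //; have := ltn_ord p; have := ltn_ord q; lia.
  by rewrite inordK //; have := ltn_ord p; have := ltn_ord q; lia.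
under [RHS]eq_bigr => l _ do under eq_bigr => p _ do rewrite mulr_suml.
rewrite [RHS]exchange_big; apply: eq_bigr => p _.
rewrite (partition_big (fun q : 'I_n.+1 => inord (q - p).-1 : 'I_n.*2.+1) xpredT) //=.
apply: eq_bigr => l _; apply: eq_big => [q|q].
  rewrite -val_eqE /= inordK //; last by have := ltn_ord p; have := ltn_ord q; lia.
  by apply/andP/eqP => [[pq /eqP]|]; lia.
rewrite -val_eqE /= inordK //; last by have := ltn_ord p; have := ltn_ord q; lia.
case/andP=> pq /eqP ql; rewrite /G D_sym (_ : D q p = E l.+1) //.
by rewrite -(D_shift p); congr D; lia.
Qed.

End CosineExpansion.

(** * The trigonometric curve *)

Lemma finitely_many_roots (F : idomainType) (z : nat -> F) (P : {poly F}) :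
  injective z -> P != 0 -> exists N, forall i, (N <= i)%N -> ~~ root P (z i).
Proof.
move=> z_inj; have [n le_n] := ubnP (size P); elim: n P le_n => // n IH P le_n P0.
have [[i Pi]|no_root] := pselect (exists i, root P (z i)); last first.
  by exists 0%N => i _; apply/negP => Pi; apply: no_root; exists i.
have [Q PE] := factor_theorem P (z i) Pi.
have Q0 : Q != 0 by apply: contraNneq P0 => Q0; rewrite PE Q0 mul0r.
have [|N hN] := IH Q _ Q0.
  by move: le_n; rewrite PE size_Mmonic ?monicXsubC // size_XsubC addn2 ltnS.
exists (maxn N i.+1) => j; rewrite geq_max => /andP[Nj ij].
rewrite PE rootM negb_or hN //= root_XsubC.
by apply: contraTneq ij => /z_inj ->; rewrite ltnn.
Qed.

Section TrigonometricCurve.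
Variables (R : realType) (m : nat) (w : 'I_m -> R) (k : 'I_m -> nat).
Hypothesis w_gt0 : forall j, 0 < w j.

Definition trig_curve (z : R[i]) : 'rV[R]_(m + m) :=
  row_mx (\row_j (Num.sqrt (w j) * complex.Re (z ^+ k j)))
         (\row_j (Num.sqrt (w j) * complex.Im (z ^+ k j))).

Lemma trig_curve_dist (z u : R[i]) :
  on_unit_circle z -> on_unit_circle u ->
  dot (trig_curve z - trig_curve u) (trig_curve z - trig_curve u) =
  2 * \sum_j w j * (1 - complex.Re ((z * u^*%C) ^+ k j)).
Proof.
move=> hz hu; rewrite dotE big_split_ord /= -big_split mulr_sumr /=.
apply: eq_bigr => j _; rewrite opp_row_mx add_row_mx row_mxEl row_mxEr !mxE.
rewrite exprMn -rmorphXn.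
have := unit_circleX (k j) hz; have := unit_circleX (k j) hu.
case: (z ^+ k j) (u ^+ k j) => [a b] [c d]; rewrite /on_unit_circle /= => hu' hz'.
rewrite -!mulrBr -!expr2 !exprMn sqr_sqrtr ?ltW // -mulrDr mulrCA; congr (_ * _).
by rewrite !sqrrB mulrN opprK; move: hz' hu'; rewrite !expr2; lra.
Qed.

Lemma trig_curve_sphere (z : R[i]) :
  on_unit_circle z -> dot (trig_curve z) (trig_curve z) = \sum_j w j.
Proof.
move=> hz; rewrite dotE big_split_ord /= -big_split /=.
apply: eq_bigr => j _; rewrite row_mxEl row_mxEr !mxE.
have := unit_circleX (k j) hz; rewrite /on_unit_circle => hz'.
by rewrite -!expr2 !exprMn sqr_sqrtr ?ltW // -mulrDr hz' mulr1.
Qed.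

(** With z = exp(it), the equation of the hyperplane is the vanishing of a
    Laurent polynomial in z whose coefficients of degrees [k j] and [- k j]
    are conjugate; they are half of the numbers [A j] below and their
    conjugates.  Multiplying by z^K with K >= k j gives a polynomial. *)
Lemma trig_curve_hyperplane (z : nat -> R[i]) (v : 'rV[R]_(m + m)) (c : R) :
  injective k -> (forall j, 0 < k j)%N ->
  injective z -> (forall i, on_unit_circle (z i)) -> v != 0 ->
  exists N, forall i, (N <= i)%N -> dot v (trig_curve (z i)) <> c.
Proof.
move=> k_inj k_gt0 z_inj z_unit v0.
pose A j := Complex (Num.sqrt (w j) * v 0 (lshift m j))
                    (- (Num.sqrt (w j) * v 0 (rshift m j))).
pose K := (\max_j k j)%N.
have kK j : (k j <= K)%N by apply: leq_bigmax.
pose P : {poly R[i]} := \sum_j (A j *: 'X^(K + k j) + (A j)^*%C *: 'X^(K - k j))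
  - (c *+ 2)%:C%C *: 'X^K.
have [j Aj] : exists j, A j != 0.
  apply/existsP; apply: contraNT v0; rewrite negb_exists => /forallP A0.
  apply/eqP/matrixP => i l; rewrite ord1 mxE.
  case: (split_ordP l) => j ->; have := A0 j; rewrite negbK eq_complex /= => /andP[].
    by rewrite mulf_eq0 sqrtr_eq0 leNgt w_gt0 /= => /eqP.
  by move=> _; rewrite oppr_eq0 mulf_eq0 sqrtr_eq0 leNgt w_gt0 /= => /eqP.
have P0 : P != 0.
  apply: contra_neq Aj => P0; have : P`_(K + k j) = 0 by rewrite P0 coef0.
  rewrite coefB coef_sum coefZ coefXn (bigD1 j) //= coefD !coefZ !coefXn eqxx mulr1.
  rewrite big1; last first.
    move=> i ij; rewrite coefD !coefZ !coefXn eqn_add2l (inj_eq k_inj) eq_sym.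
    rewrite (negbTE ij) (_ : (_ == _) = false) ?mulr0 ?addr0 //.
    by have := k_gt0 j; lia.
  rewrite (_ : (K + k j == K - k j)%N = false); last by have := k_gt0 j; lia.
  rewrite (_ : (K + k j == K)%N = false); last by have := k_gt0 j; lia.
  by rewrite !mulr0 !addr0 subr0.
have [N hN] := finitely_many_roots z_inj P0.
exists N => i /hN /negP Pz vz; apply: Pz; apply/rootP.
have zz : z i * (z i)^*%C = 1 by exact: mul_conj_unit (z_unit i).
have -> : P.[z i] = z i ^+ K * (\sum_j (A j * z i ^+ k j + (A j * z i ^+ k j)^*%C)
    - (c *+ 2)%:C%C).
  rewrite hornerD hornerN hornerZ hornerXn horner_sum mulrBr [in RHS]mulrC.
  congr (_ - _); last by rewrite mulrC.
  rewrite mulr_suml; apply: eq_bigr => l _.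
  rewrite hornerD !hornerZ !hornerXn rmorphM rmorphXn mulrDl exprD.
  congr (_ + _); first by rewrite mulrA mulrAC.
  rewrite -mulrA; congr (_ * _).
  by rewrite -{2}(subnK (kK l)) exprD mulrCA -exprMn [_^*%C * _]mulrC zz expr1n mulr1.
apply/eqP; rewrite mulf_eq0; apply/orP; right; rewrite subr_eq0; apply/eqP.
rewrite -vz dotE big_split_ord /= -big_split /= mulr2n rmorphD !rmorph_sum -big_split /=.
apply: eq_bigr => l _; rewrite row_mxEl row_mxEr !mxE /A.
case: (z i ^+ k l) => a b; apply/eqP; rewrite eq_complex /=.
by apply/andP; split; apply/eqP; ring.
Qed.

End TrigonometricCurve.

(** * Spherical sets in every even dimension *)

Lemma ratr_conv_coef (R : realType) (b : nat -> rat) (n l : nat) :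
  conv_coef (fun p => ratr (b p) : R) n l = ratr (conv_coef b n l).
Proof.
rewrite /conv_coef rmorphB rmorphMn !rmorph_sum; congr (_ - _ *+ 2).
  apply: eq_bigr => p _; rewrite rmorph_sum.
  by apply: eq_bigr => q _; rewrite rmorphM.
apply: eq_bigr => p _; rewrite rmorph_sum.
by apply: eq_bigr => q _; rewrite rmorphM.
Qed.

(** Points of the curve with the frequencies of the nonzero coefficients of
    [convolution_weights]. *)
Lemma spherical_rational_sequence (R : realType) (m : nat) : (0 < m)%N ->
  exists p : nat -> 'rV[R]_(m + m),
  [/\ injective p, affinely_general p,
      forall i j, rational (enorm (p i - p j)) &
      exists r, forall i, dot (p i) (p i) = r].
Proof.
case: m => // m' _; set m := m'.+1.
have [n [e [b [me b0 b_gt0]]]] := convolution_weights (ltn0Sn m').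
pose B p : R := ratr (b p).
pose w (j : 'I_m) := conv_coef B n (j + e).
pose k (j : 'I_m) := (j + e).+1.*2.
have w_gt0 j : 0 < w j.
  by rewrite /w ratr_conv_coef ltr0q b_gt0 //; have := ltn_ord j; lia.
have k_gt0 j : (0 < k j)%N by [].
have k_inj : injective k.
  by move=> i j /double_inj[/addIn ij]; apply: val_inj.
pose z := @rational_circle_point R.
pose g i := trig_curve w k (z i) : 'rV_(m' + m).+1.
have [s [s_inj s_gen]] := greedy_affinely_general (fun v c => @trig_curve_hyperplane
  R m w k w_gt0 z v c k_inj k_gt0 (@rational_circle_point_inj R)
  (@rational_circle_point_unit R)).
exists (g \o s); split=> //; last first.
  exists (\sum_j w j) => i; apply: trig_curve_sphere => //.
  exact: rational_circle_point_unit.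
move=> i j /=; set y := z (s i) * (z (s j))^*%C.
have [zi zj] := (rational_circle_point_unit R (s i), rational_circle_point_unit R (s j)).
have y_unit : on_unit_circle y by apply: unit_circleM => //; exact: unit_circleJ.
have y_rat : rational_complex y.
  apply: rational_complexM; first exact: rational_circle_point_rational.
  by apply: rational_complexJ; exact: rational_circle_point_rational.
(* The distance of the points with parameters z and u is 2 |f| for the sum of
   sines f at y = z u^*. *)
pose f := \sum_(p < n.+1) B p * complex.Im (y ^+ p.*2.+1).
have f_rat : rational f.
  apply: rational_sum => p _; apply: rationalM; first exact: rational_ratr.
  by have [] := rational_complexX p.*2.+1 y_rat.
rewrite enormE /g (trig_curve_dist k w_gt0) //.
suff -> : \sum_j w j * (1 - complex.Re (y ^+ k j)) = f ^+ 2 *+ 2.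
  rewrite (_ : 2 * _ = (2 * f) ^+ 2); last by ring.
  rewrite sqrtr_sqr; apply: rational_norm; apply: rationalM => //.
  exact: rational_nat.
rewrite (sine_sum_square y_unit) -me.
pose T l := conv_coef B n l * (1 - complex.Re (y ^+ l.+1.*2)).
(* The first e coefficients vanish; the remaining ones are the w j. *)
rewrite -(big_mkord xpredT T) (big_cat_nat _ (n := e)) //=; last exact: leq_addl.
rewrite [in RHS]big_nat [X in _ = X + _]big1 ?add0r => [|l le]; last first.
  by rewrite /T ratr_conv_coef b0 // rmorph0 mul0r.
by rewrite -{1}[e]add0n big_addn addnK big_mkord.
Qed.

(** * Inversion of a spherical set about one of its points *)

Definition householder (F : fieldType) (d : nat) (a x : 'rV[F]_d) : 'rV[F]_d :=
  x - (2 * dot x a / dot a a) *: a.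

Lemma householder_dot (F : realFieldType) (d : nat) (a x y : 'rV[F]_d) :
  dot (householder a x) (householder a y) = dot x y.
Proof.
have [->|a0] := eqVneq a 0; first by rewrite /householder !scaler0 !subr0.
rewrite -dot_eq0 in a0.
by rewrite /householder !dotDE (dotC a y); field.
Qed.

Lemma householder_swap (F : realFieldType) (d : nat) (x y : 'rV[F]_d) :
  dot x x = dot y y -> householder (x - y) x = y.
Proof.
move=> xy; rewrite /householder; have [e|] := eqVneq (x - y) 0.
  by rewrite e scaler0 subr0; apply/eqP; rewrite -subr_eq0 e.
rewrite -dot_eq0 (_ : dot (x - y) (x - y) = 2 * dot x (x - y)).
  by move=> n0; rewrite divff // scale1r opprB addrC subrK.
by rewrite !dotDE (dotC y x) -xy; ring.
Qed.

Definition householder_mx (F : fieldType) (d : nat) (a : 'rV[F]_d) : 'M[F]_d :=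
  1%:M - (2 / dot a a) *: (a^T *m a).

Lemma mul_householder_mx (F : fieldType) (d : nat) (a x : 'rV[F]_d) :
  x *m householder_mx a = householder a x.
Proof.
rewrite mulmxBr mulmx1 -scalemxAr mulmxA; congr (_ - _).
rewrite [x *m a^T]mx11_scalar mul_scalar_mx scalerA; congr (_ *: _).
by rewrite -/(dot x a) mulrAC.
Qed.

(** The reflection exchanging o and |o| e_0 carries the hyperplane orthogonal to
    o onto the vectors whose coordinate 0 vanishes; that coordinate is then
    dropped. *)
Lemma hyperplane_isometry (R : rcfType) (d : nat) (o : 'rV[R]_d.+1) :
  o != 0 -> exists U : 'M[R]_(d.+1, d), forall x y,
    dot x o = 0 -> dot y o = 0 -> dot (x *m U) (y *m U) = dot x y.
Proof.
move=> o0; pose rho := Num.sqrt (dot o o).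
have rho_sq : rho ^+ 2 = dot o o by rewrite sqr_sqrtr ?dot_ge0.
have rho0 : rho != 0 by rewrite -sqrf_eq0 rho_sq dot_eq0.
have dot_e0 x : dot x (delta_mx 0 0) = x 0 0.
  rewrite dotE (bigD1 0) //= big1 ?mxE ?eqxx ?mulr1 ?addr0 // => i i0.
  by rewrite mxE (negbTE i0) andbF mulr0.
pose a := o - rho *: delta_mx 0 0; pose M := householder_mx a.
have M_dot x y : dot (x *m M) (y *m M) = dot x y.
  by rewrite !mul_householder_mx householder_dot.
have M_o : o *m M = rho *: delta_mx 0 0.
  rewrite mul_householder_mx householder_swap // !dotDE dot_e0 mxE eqxx mulr1.
  by rewrite -rho_sq expr2.
exists (col' ord0 M) => x y xo yo.
have colE u i : (u *m col' ord0 M) 0 i = (u *m M) 0 (lift ord0 i).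
  rewrite [LHS]mxE [RHS]mxE; apply: eq_bigr => k _.
  by rewrite [col' _ _ _ _]mxE.
have split_dot u v : dot (u *m M) (v *m M) =
    (u *m M) 0 0 * (v *m M) 0 0 + dot (u *m col' ord0 M) (v *m col' ord0 M).
  rewrite 2!dotE big_ord_recl; congr (_ + _); apply: eq_bigr => i _.
  by rewrite !colE.
have xM0 u : dot u o = 0 -> (u *m M) 0 0 = 0.
  by move=> uo; apply: (mulfI rho0); rewrite mulr0 -dot_e0 -dotZr -M_o M_dot.
by have := split_dot x y; rewrite xM0 // mul0r add0r => <-; rewrite M_dot.
Qed.

(** The square matrix with rows (1, p_i) is invertible, and (-c, v) is in its
    kernel. *)
Lemma affinely_independent_hyperplane (R : realType) (d : nat)
    (p : 'I_d.+1 -> 'rV[R]_d) (v : 'rV[R]_d) (c : R) :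
  affinely_independent p -> (forall i, dot (p i) v = c) -> v = 0 /\ c = 0.
Proof.
move=> p_ind pv.
pose M : 'M[R]_(d.+1, 1 + d) := row_mx (const_mx 1) (\matrix_i p i).
pose u : 'rV[R]_(1 + d) := row_mx (const_mx (- c)) v.
have [u0|u0] := eqVneq u 0.
  have [/matrixP/(_ 0 0)] := eq_row_mx (etrans u0 (esym (row_mx0 _ _ _ _))).
  by rewrite !mxE => /eqP; rewrite oppr_eq0 => /eqP -> ->.
have Mu : u *m M^T = 0.
  rewrite tr_row_mx mul_row_col; apply/matrixP => i j; rewrite ord1 !mxE.
  rewrite big_ord1 !mxE mulr1 -(pv j) dotE addrC; apply/eqP; rewrite subr_eq0.
  by apply/eqP; apply: eq_bigr => l _; rewrite !mxE mulrC.
have /det0P[a a0 aM] : \det M == 0.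
  by rewrite -det_tr; apply/det0P; exists u.
case/negP: a0; apply/eqP/matrixP => i j; rewrite ord1 mxE.
have {}aM : @mulmx R 1 d.+1 (1 + d) a M = 0 by [].
move: aM; rewrite /M mul_mx_row -row_mx0 => /eq_row_mx[a_sum a_comb].
apply: p_ind j.
  move/matrixP/(_ 0 0): a_sum; rewrite !mxE => e; rewrite -[RHS]e.
  by apply: eq_bigr => l _; rewrite mxE mulr1.
rewrite -[RHS]a_comb; apply/matrixP => k l; rewrite summxE mxE ord1.
by apply: eq_bigr => m _; rewrite !mxE.
Qed.

Definition general_sequence (R : realType) (d : nat) (y : nat -> 'rV[R]_d) :=
  affinely_general y /\
  forall t : 'I_d.+2 -> nat, injective t -> ~ cospherical (y \o t).

(** The image of x is (x - o) / |x - o|^2, translated by o / (2 r) so that it is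
    orthogonal to o, then read in R^d through an isometry [U]. *)
Lemma invert_spherical (R : realType) (d : nat) (p : nat -> 'rV[R]_d.+1) (r : R) :
  injective p -> affinely_general p ->
  (forall i j, rational (enorm (p i - p j))) ->
  (forall i, dot (p i) (p i) = r) ->
  exists y : nat -> 'rV[R]_d,
    [/\ injective y, general_sequence y &
        forall i j, rational (enorm (y i - y j))].
Proof.
move=> p_inj p_gen p_rat p_sph.
pose o := p 0%N; pose x i := p i.+1.
pose q i := dot (x i - o) (x i - o).
have x_inj : injective x by move=> i j /p_inj[].
have x_o i : x i - o != 0 by rewrite subr_eq0; apply/eqP => /p_inj.
have q0 i : q i != 0 by rewrite dot_eq0.
have qE i : q i = 2 * r - 2 * dot (x i) o.
  by rewrite /q !dotDE (dotC o) !p_sph; ring.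
have r0 : r != 0.
  apply: contraNneq (x_o 0%N) => r0.
  have p0 i : p i = 0 by apply/eqP; rewrite -dot_eq0 p_sph r0.
  by rewrite /x /o !p0 subrr.
have o0 : o != 0 by rewrite -dot_eq0 p_sph.
have [U U_iso] := hyperplane_isometry o0.
have [u uE] : exists u : nat -> 'rV[R]_d.+1, forall i,
    u i = (q i)^-1 *: (x i - o) + (2 * r)^-1 *: o.
  by exists (fun i => (q i)^-1 *: (x i - o) + (2 * r)^-1 *: o).
have uo i : dot (u i) o = 0.
  rewrite uE !dotDE p_sph; have := q0 i; rewrite qE => q0i.
  by field; rewrite r0.
pose y i := u i *m U.
have y_dist i j : dot (y i - y j) (y i - y j) =
    dot (x i - x j) (x i - x j) / (q i * q j).
  have uijo : dot (u i - u j) o = 0 by rewrite !dotDE !uo subrr.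
  rewrite /y -mulmxBl U_iso // !uE !dotDE.
  have := q0 i; have := q0 j; rewrite !qE => q0i q0j.
  rewrite !p_sph (dotC (x j) (x i)) (dotC o (x i)) (dotC o (x j)).
  by field; rewrite r0 q0i q0j.
have y_enorm i j : enorm (y i - y j) =
    enorm (x i - x j) / (enorm (x i - o) * enorm (x j - o)).
  rewrite !enormE y_dist sqrtrM ?dot_ge0 // sqrtrV ?mulr_ge0 ?dot_ge0 //.
  by rewrite sqrtrM ?dot_ge0.
exists y; split; last first.
- move=> i j; rewrite y_enorm; apply: rationalM; first exact: p_rat.
  by apply: rationalV; apply: rationalM; exact: p_rat.
- split=> t t_inj.
    move=> c c_sum cy j.
    pose v := \sum_i c i *: u (t i).
    have vE : v = \sum_i (c i / q (t i)) *: (x (t i) - o).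
      rewrite /v; under eq_bigr => i _ do rewrite uE scalerDr !scalerA.
      rewrite big_split /= -[X in _ + X]scaler_suml -mulr_suml c_sum.
      by rewrite mul0r scale0r addr0.
    have v0 : v = 0.
      have vo : dot v o = 0.
        by rewrite dotC dot_sumr big1 // => i _; rewrite dotZr dotC uo mulr0.
      apply/eqP; rewrite -dot_eq0 -U_iso // mulmx_suml.
      rewrite (eq_bigr (fun i => c i *: (y \o t) i)) ?cy; last first.
        by move=> i _; rewrite scalemxAl.
      by rewrite dot_eq0.
    (* v = 0 is an affine relation between o and the d + 1 points x (t i). *)
    pose t' k := if unlift ord0 k is Some i then (t i).+1 else 0%N.
    have t'_inj : injective t'.
      move=> k l; rewrite /t'.
      by case: unliftP => [i ->|->]; case: unliftP => [i' ->|->] // [/t_inj ->].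
    pose c' k := if unlift ord0 k is Some i then c i / q (t i)
                 else - \sum_i c i / q (t i).
    have c'0 k : c' k = 0.
      apply: (p_gen t' t'_inj); rewrite big_ord_recl /c' unlift_none /=.
        under [X in _ + X]eq_bigr => i _ do rewrite liftK.
        by rewrite addNr.
      rewrite /t' unlift_none; under [X in _ + X]eq_bigr => i _ do rewrite !liftK.
      rewrite scaleNr scaler_suml addrC -sumrB -[RHS]v0 vE.
      by apply: eq_bigr => i _; rewrite scalerBr.
    have := c'0 (lift ord0 j); rewrite /c' liftK => /eqP.
    by rewrite mulf_eq0 invr_eq0 (negbTE (q0 _)) orbF => /eqP.
  move=> [o' [r' [r'_gt0 yo']]].
  (* Multiplied by q i = |x_i - o|^2, the equation of the sphere becomes affine in
     x_i; at x_i = o its left-hand side would be 1, so it is not trivial. *)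
  pose h := o' *m U^T.
  pose C := dot o' o' - r' ^+ 2 - (4 * r)^-1 - dot o h / r.
  have hyp i : 1 + C * q (t i) - 2 * dot (x (t i) - o) h = 0.
    have := yo' i; rewrite enormE => /(congr1 (fun a => a ^+ 2)).
    rewrite sqr_sqrtr ?dot_ge0 //= !dotDE (dotC o') U_iso ?uo // dot_mulmx -/h.
    rewrite uE /C !dotDE => /eqP; rewrite -subr_eq0 => /eqP e.
    have := q0 (t i); move: e; rewrite !p_sph !(dotC o (x _)) qE => e q0i.
    by rewrite -[RHS](mulr0 (2 * r - 2 * dot (x (t i)) o)) -e; field; rewrite r0 q0i.
  have t1_inj : injective (fun i => (t i).+1) by move=> i j [/t_inj].
  pose v := - (2 * C) *: o - 2 *: h.
  have pv i : dot (x (t i)) v = - (1 + 2 * C * r + 2 * dot o h).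
    have := hyp i; rewrite /v qE !dotDE; lra.
  have [v0 c0] := affinely_independent_hyperplane (p_gen _ t1_inj) pv.
  have : dot o v = 0 by rewrite v0 /dot trmx0 mulmx0 mxE.
  by rewrite /v !dotDE p_sph; lra.
move=> i j yij; apply: x_inj; apply/eqP; rewrite -subr_eq0 -dot_eq0.
have := y_dist i j; rewrite yij subrr /dot mul0mx mxE => /esym/eqP.
by rewrite !mulf_eq0 invr_eq0 mulf_eq0 !(negbTE (q0 _)) !orbF.
Qed.

(** * Infinite sets at rational distances *)

Lemma range_sequence (R : realType) (d : nat) (y : nat -> 'rV[R]_d) :
  injective y -> range y #= [set: nat].
Proof. by move=> y_inj; apply: inj_card_eq => i j _ _; apply: y_inj. Qed.

Lemma range_indices (T : Type) (k : nat) (y : nat -> T) (p : 'I_k -> T) :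
  injective p -> (forall i, range y (p i)) ->
  exists2 t : 'I_k -> nat, injective t & p = y \o t.
Proof.
move=> p_inj py.
have /choice[t ht] : forall i, exists n, y n = p i.
  by move=> i; have [n _ <-] := py i; exists n.
exists t; last by apply/funext => i; rewrite /= ht.
by move=> i j tij; apply: p_inj; rewrite -!ht tij.
Qed.

Lemma range_affine_general (R : realType) (d : nat) (y : nat -> 'rV[R]_d) :
  affinely_general y -> affine_general_position (range y).
Proof. by move=> y_gen p p_inj /(range_indices p_inj)[t t_inj ->]; apply: y_gen. Qed.

Lemma range_general (R : realType) (d : nat) (y : nat -> 'rV[R]_d) :
  general_sequence y -> general_position (range y).
Proof.
move=> [y_gen y_sph]; split; first exact: range_affine_general.
by move=> p p_inj /(range_indices p_inj)[t t_inj ->]; apply: y_sph.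
Qed.

Lemma range_rational (R : realType) (d : nat) (y : nat -> 'rV[R]_d) :
  (forall i j, rational (enorm (y i - y j))) -> rational_distances (range y).
Proof. by move=> y_rat _ _ [i _ <-] [j _ <-]. Qed.

Theorem theorem1p2 (R : realType) (d : nat) (hd : (1 <= d)%N) :
  (exists X : set 'rV[R]_d,
     [/\ X #= [set: nat], rational_distances X & affine_general_position X]) /\
  (odd d ->
   exists X : set 'rV[R]_d,
     [/\ X #= [set: nat], rational_distances X & general_position X]).
Proof.
have odd_case : odd d -> exists X : set 'rV[R]_d,
    [/\ X #= [set: nat], rational_distances X & general_position X].
  move=> d_odd; have d1 : d.+1 = (uphalf d + uphalf d)%N.
    by have := odd_double_half d; rewrite uphalf_half d_odd; lia.
  have [|p [p_inj p_gen p_rat [r p_sph]]] := @spherical_rational_sequence R (uphalf d).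
    by case: d hd {d_odd d1}.
  move: p p_inj p_gen p_rat p_sph; rewrite -d1 => p p_inj p_gen p_rat p_sph.
  have [y [y_inj y_gen y_rat]] := invert_spherical p_inj p_gen p_rat p_sph.
  exists (range y); split; [exact: range_sequence|exact: range_rational|].
  exact: range_general.
split=> //; have [/odd_case[X [cX rX [gX _]]]|d_even] := boolP (odd d).
  by exists X.
have d2 : d = (d./2 + d./2)%N by rewrite addnn even_halfK.
have [|p [p_inj p_gen p_rat _]] := @spherical_rational_sequence R d./2.
  by move: hd d2; lia.
move: p p_inj p_gen p_rat; rewrite -d2 => p p_inj p_gen p_rat.
exists (range p); split; [exact: range_sequence|exact: range_rational|].
exact: range_affine_general.
Qed.
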